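(* For any linear differential operator $\mathfrak{D}$ with polynomial coefficients and any $p$ (the number of interior discontinuity points), $$\tau(\mathfrak{D},p)\le\sigma(\mathfrak{D},2p).$$
   Context: Let $[a,b]\subset\mathbb{R}$ be an interval, and let $\mathfrak{D}$ be a linear differential operator of order $n$ with polynomial coefficients, $$\mathfrak{D}=p_n(x)\partial^n+\dots+p_1(x)\partial+p_0(x)\,\mathrm{I},\qquad \partial=\frac{d}{dx},\quad \deg p_j\le d_j,$$ where $\mathrm{I}$ is the identity operator. A function $f$ belongs to the class $\mathcal{PD}(\mathfrak{D},p)$ if $f:[a,b]\to\mathbb{R}$ is a bounded piecewise-continuous function with points of discontinuity (of the first kind) $$a=\xi_0<\xi_1<\dots<\xi_p<\xi_{p+1}=b,$$ satisfying on each continuity interval $[\xi_j,\xi_{j+1}]$ the linear homogeneous ODE $\mathfrak{D}f\equiv0$. Moments: $m_k(f)=\int_a^b x^k f(x)\,dx$, $k=0,1,2,\dots$. Moment vanishing index of $\mathcal{PD}(\mathfrak{D},p)$: $$\sigma(\mathfrak{D},p)=\sup_{f\in\mathcal{PD}(\mathfrak{D},p),\ f\not\equiv0}\{k:\ m_0(f)=\dots=m_k(f)=0\}+1.$$ Moment uniqueness index: $$\tau(\mathfrak{D},p)=\sup_{f,g\in\mathcal{PD}(\mathfrak{D},p),\ f\not\equiv g}\{k:\ m_j(f)=m_j(g),\ 0\le j\le k\}+1.$$ *)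

(* Defs.v *)
From mathcomp Require Import all_boot all_order all_algebra.
From mathcomp Require Import all_classical all_reals all_analysis.

Set Implicit Arguments.
Unset Strict Implicit.
Unset Printing Implicit Defensive.

Import Order.TTheory GRing.Theory Num.Theory.
Import numFieldNormedType.Exports.

Local Open Scope classical_set_scope.
Local Open Scope ring_scope.

(* The operator p_n(x) d^n + ... + p_1(x) d + p_0(x) I, with p_j = do_coef j
   and n = do_order. *)
Record diff_op (R : realType) := DiffOp {
  do_order : nat;
  do_coef : 'I_do_order.+1 -> {poly R};
  do_lead_neq0 : do_coef ord_max != 0 }.

(* Differentiability relative to A: when A is a closed interval, this is the
   one-sided derivative at each endpoint. *)
Definition has_deriv_on (R : realType) (A : set R) (g g' : R -> R) : Prop :=
  forall x, A x -> (fun y => (g y - g x) / (y - x)) @ within A x^' --> g' x.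

(* g is n times differentiable on A, with G k its k-th derivative there, and
   satisfies D g = 0 at every point of A. No continuity of the n-th derivative
   is assumed, and the leading coefficient may vanish on A. Continuity of g on
   A is redundant unless n = 0. *)
Definition solves_on (R : realType) (D : diff_op R) (A : set R) (g : R -> R) :
  Prop :=
  {within A, continuous g} /\
  exists G : nat -> R -> R,
    [/\ forall x, A x -> G 0 x = g x,
        forall k, (k < do_order D)%N -> has_deriv_on A (G k) (G k.+1)
      & forall x, A x -> \sum_(k < (do_order D).+1) (do_coef k).[x] * G k x = 0].

(* The class PD(D, p) on [a, b]. The sequence a :: s lists the points
   xi_0 < ... < xi_(p+1). On each open piece f agrees with a continuous
   solution g on the closed piece: this expresses both that the one-sided limits
   of f at the xi_j exist and that f, extended to the closed piece by these
   limits, satisfies the equation. The values of f at the xi_j themselves are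
   unconstrained, and f may happen to be continuous at some xi_j. *)
Definition PD (R : realType) (a b : R) (D : diff_op R) (p : nat) :
  set (R -> R) :=
  [set f | [bounded f x | x in `[a, b]%classic] /\
    exists s : seq R,
      [/\ itv_partition a b s, size s = p.+1
        & forall j, (j <= p)%N ->
            let u := nth b (a :: s) j in
            let v := nth b (a :: s) j.+1 in
            exists g : R -> R,
              solves_on D `[u, v]%classic g /\
              forall x, x \in `]u, v[ -> f x = g x]].

Definition moment (R : realType) (a b : R) (k : nat) (f : R -> R) : R :=
  \int[lebesgue_measure]_(x in `[a, b]) (x ^+ k * f x).

(* Since the values at the xi_j are arbitrary and invisible to the moments,
   functions are identified when they agree almost everywhere on [a, b]; within
   the classes PD this means agreement off finitely many points. *)
Definition same_on (R : realType) (a b : R) (f g : R -> R) : Prop :=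
  f = g %[ae (@lebesgue_measure R) in `[a, b]%classic].

(* The indices are extended reals: +oo if the set of k is unbounded, and
   ereal_sup set0 = -oo if it is empty. *)
Definition moment_vanishing_index (R : realType) (a b : R) (D : diff_op R)
    (p : nat) : \bar R :=
  (ereal_sup [set k%:R%:E | k in [set k : nat |
     exists f : R -> R, [/\ PD a b D p f, ~ same_on a b f (cst 0%R)
       & forall j, (j <= k)%N -> moment a b j f = 0%R]]] + 1)%E.

Definition moment_uniqueness_index (R : realType) (a b : R) (D : diff_op R)
    (p : nat) : \bar R :=
  (ereal_sup [set k%:R%:E | k in [set k : nat |
     exists f g : R -> R, [/\ PD a b D p f, PD a b D p g, ~ same_on a b f g
       & forall j, (j <= k)%N -> moment a b j f = moment a b j g]]] + 1)%E.

(* Main.v *)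
(* The difference of two functions of PD(D, p) solves the equation between
   consecutive points of the union of the two sets of discontinuities, which has
   at most 2p interior points, and moments are linear. Since PD(D, 2p) demands
   exactly 2p interior points, the union is padded with spurious ones. *)
Require Import Defs.
From mathcomp Require Import all_boot all_order all_algebra.
From mathcomp Require Import all_classical all_reals all_analysis.
From mathcomp Require Import measurable_realfun lra.

Set Implicit Arguments.
Unset Strict Implicit.
Unset Printing Implicit Defensive.

Import Order.TTheory GRing.Theory Num.Theory.
Import numFieldNormedType.Exports.

Local Open Scope classical_set_scope.
Local Open Scope ring_scope.

(** * Partitions of the interval: padding, common refinement, passage to pieces *)

Lemma itv_partition_pad (R : realType) (a b : R) (s : seq R) (n : nat) :
    (a < b)%R -> itv_partition a b s -> (size s <= n)%N ->
  exists t, [/\ itv_partition a b t, size t = n & {subset s <= t}].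
Proof.
move=> ab abs /subnK <-; elim: (n - size s)%N => [|m [t [abt st sub]]].
  by exists s; split.
case: t st abt sub => [_ /itv_partition_nil eab|c t st].
  by rewrite eab ltxx in ab.
move=> [/= /andP[ac ct] lt] sub.
(* The gap between [a] and the first point [c] is never empty, so a spurious point always fits
   there. *)
exists ((a + c) / 2 :: c :: t); split => /=.
- split=> //=; rewrite ct midf_lt// andbT; lra.
- by rewrite addSn -st.
- by move=> x /sub xs; rewrite inE xs orbT.
Qed.

(** Both lists end with [b], which their union needs only once; hence [n.+1] in the size bound.
    Padding then brings the size to exactly [n]. *)
Lemma itv_partition_common (R : realType) (a b : R) (s1 s2 : seq R) (n : nat) :
    (a < b)%R -> itv_partition a b s1 -> itv_partition a b s2 ->
    (size s1 + size s2 <= n.+1)%N ->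
  exists t, [/\ itv_partition a b t, size t = n, {subset s1 <= t} &
    {subset s2 <= t}].
Proof.
move=> ab; case: s1 / (lastP s1) => [/itv_partition_nil eab|s1 c].
  by rewrite eab ltxx in ab.
move=> [as1 /eqP]; rewrite last_rcons => cb [as2 /eqP lb2] szn; subst c.
have b2 : b \in s2.
  by case: s2 as2 lb2 szn => [_ /= ba|y s2 _ /= <- _]; [lra|exact: mem_last].
(* Here [s1] has already lost its last entry [b], which [s2] still supplies. *)
pose t := sort <=%O (undup (s1 ++ s2)).
have tE x : (x \in t) = (x \in s1) || (x \in s2).
  by rewrite mem_sort mem_undup mem_cat.
have tP x : x \in t -> a < x <= b.
  have path_bounds s : path <%O a s -> last a s = b -> x \in s -> a < x <= b.
    move=> as_ ls xs; rewrite (allP (order_path_min lt_trans as_))//=.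
    move: as_ ls; case/splitPr: xs => p1 p2; rewrite cat_path last_cat /=.
    move=> /and3P[_ _ xp2] <-.
    have := mem_last x p2; rewrite inE => /predU1P[->//|/=].
    by move/(allP (order_path_min lt_trans xp2))/ltW.
  rewrite tE => /orP[xs1|]; last exact: path_bounds.
  apply: path_bounds as1 _ _; rewrite ?last_rcons//.
  by rewrite mem_rcons inE xs1 orbT.
have abt : itv_partition a b t.
  split.
    rewrite path_sortedE; last exact: lt_trans.
    rewrite sort_lt_sorted undup_uniq andbT; apply/allP => x /tP/andP[]//.
  have tb : b \in t by rewrite tE b2 orbT.
  have tS : path <=%O a t.
    rewrite path_sortedE; last exact: le_trans.
    rewrite sort_le_sorted andbT; apply/allP => x /tP/andP[/ltW]//.
  (* The last entry of [t] is at most [b] by the bounds [tP], and at least [b] because [b] occurs in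
     the sorted list [t]. *)
  rewrite eq_le; apply/andP; split.
    have := mem_last a t; rewrite inE => /predU1P[->|/tP/andP[]//].
    exact: ltW.
  move: tS; case/splitPr: tb => p1 p2; rewrite cat_path last_cat /=.
  move=> /and3P[_ _ bp2]; have := mem_last b p2; rewrite inE => /predU1P[->//|].
  by move/(allP (order_path_min le_trans bp2)).
have szt : (size t <= n)%N.
  rewrite size_sort (leq_trans (size_undup _))// size_cat.
  by rewrite size_rcons addSn ltnS in szn.
have [t' [abt' st' sub]] := itv_partition_pad ab abt szt.
exists t'; split=> // x xs; apply: sub; rewrite tE.
  by move: xs; rewrite mem_rcons inE => /predU1P[->|->//]; rewrite b2 orbT.
by rewrite xs orbT.
Qed.

(** Each piece of the finer partition lies inside a single piece of the coarser one, and [Q] passes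
    to subintervals. *)
Lemma itv_partition_refine (R : realType) (a b : R) (Q : R -> R -> Prop)
    (s t : seq R) :
    (forall u u' v' v, u <= u' -> v' <= v -> Q u v -> Q u' v') ->
    itv_partition a b s -> itv_partition a b t -> {subset s <= t} ->
    (forall j, (j < size s)%N -> Q (nth b (a :: s) j) (nth b (a :: s) j.+1)) ->
  forall j, (j < size t)%N -> Q (nth b (a :: t) j) (nth b (a :: t) j.+1).
Proof.
move=> Qmono abs abt st Qs j jt.
set u := nth b (a :: t) j; set v := nth b (a :: t) j.+1.
have tS : sorted <%O (a :: t) by case: abt.
have uv : u < v by rewrite (lt_sorted_ltn_nth _ tS) ?inE/= ?ltnS// ltnW.
have vb : v <= b by apply: itv_partition_nth_le.
have au : a <= u by apply: itv_partition_nth_ge => //; rewrite ltnS ltnW.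
(* The coarse piece containing [[u, v]] starts at the last point of [a :: s] not exceeding [u]. It
   is not the final point [b], since [u < v <= b]. *)
pose P i := (i <= size s)%N && (nth b (a :: s) i <= u).
have exP : exists i, P i by exists 0%N.
have leP i : P i -> (i <= size s)%N by case/andP.
case: (ex_maxnP exP leP) => i /andP[is_ iu] imax.
have {}is_ : (i < size s)%N.
  rewrite ltn_neqAle is_ andbT; apply/eqP => ei; move: iu.
  by rewrite ei (itv_partition_nth_size _ abs) leNgt (lt_le_trans uv).
apply: Qmono iu _ (Qs _ is_).
have ui : u < nth b (a :: s) i.+1.
  rewrite ltNge; apply/negP => iu'; have := imax i.+1.
  by rewrite /P is_ iu' ltnn => /(_ isT).
(* The next coarse point exceeds [u] and is also a point of [t], so it cannot precede [v], the
   successor of [u] in [t]. *)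
have /(nthP b)[k kt ek] : nth b (a :: s) i.+1 \in t.
  by apply: st; exact: mem_nth.
move: ui; rewrite -ek -[nth b t k]/(nth b (a :: t) k.+1).
rewrite (lt_sorted_ltn_nth _ tS) ?inE/= ?ltnS//; last exact: ltnW.
move=> jk; rewrite -[nth b t k]/(nth b (a :: t) k.+1) /v.
by rewrite (lt_sorted_leq_nth _ tS) ?inE/= ?ltnS.
Qed.

(** * Restrictions and differences of solutions *)

Lemma has_deriv_on_subset (R : realType) (A B : set R) (g g' : R -> R) :
  A `<=` B -> has_deriv_on B g g' -> has_deriv_on A g g'.
Proof.
move=> AB gB x Ax; apply: cvg_trans (gB x (AB _ Ax)).
apply: (@cvg_app _ _ (within A x^') (within B x^')); exact: within_subset.
Qed.

Lemma has_deriv_onB (R : realType) (A : set R) (g g' h h' : R -> R) :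
  has_deriv_on A g g' -> has_deriv_on A h h' ->
  has_deriv_on A (g \- h) (g' \- h').
Proof.
move=> gA hA x Ax; apply: cvg_trans (cvgB (gA x Ax) (hA x Ax)).
apply: near_eq_cvg; apply: nearW => y.
by rewrite !fctE -mulrBl; congr (_ * _) => /=; lra.
Qed.

Lemma solves_on_subset (R : realType) (D : diff_op R) (A B : set R)
    (g : R -> R) :
  A `<=` B -> solves_on D B g -> solves_on D A g.
Proof.
move=> AB [cg [G [G0 GS Geq]]]; split; first exact: continuous_subspaceW cg.
exists G; split=> [x /AB/G0//|k /GS|x /AB/Geq//].
exact: has_deriv_on_subset.
Qed.

Lemma solves_onB (R : realType) (D : diff_op R) (A : set R) (g h : R -> R) :
  solves_on D A g -> solves_on D A h -> solves_on D A (g \- h).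
Proof.
move=> [cg [G [G0 GS Geq]]] [ch [H [H0 HS Heq]]]; split.
  by move=> x; exact: cvgB (cg x) (ch x).
exists (fun k => G k \- H k); split=> [x Ax|k kD|x Ax].
- by rewrite /= G0// H0.
- exact: has_deriv_onB (GS k kD) (HS k kD).
- under eq_bigr do rewrite /= mulrBr.
  by rewrite sumrB Geq// Heq// subrr.
Qed.

Lemma boundedB (R : realType) (A : set R) (f g : R -> R) :
  [bounded f x | x in A] -> [bounded g x | x in A] ->
  [bounded (f \- g) x | x in A].
Proof.
(* Boundedness provides the estimate only for constants strictly above [M] and [N], hence the added
   ones. *)
move=> [M [Mr fM]] [N [Nr gN]]; exists (M + 1 + (N + 1)); split=> [|K MNK x Ax].
  exact: num_real.
apply: le_trans (ler_normB _ _) (le_trans _ (ltW MNK)).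
by apply: lerD; [apply: fM | apply: gN]; rewrite // ltrDl.
Qed.

Lemma PDB (R : realType) (a b : R) (D : diff_op R) (p : nat) (f g : R -> R) :
  (a < b)%R -> PD a b D p f -> PD a b D p g -> PD a b D (2 * p) (f \- g).
Proof.
move=> ab [bf [s [abs ss fs]]] [bg [t [abt st gt]]].
split; first exact: boundedB.
(* The lists hold [p.+1] entries each, including [b]; merging the two copies of [b] leaves at most
   [(2 * p).+1], the length required by [PD] for [2 * p]. *)
have szn : (size s + size t <= (2 * p).+2)%N.
  by rewrite ss st mul2n -addnn addnS addSn.
have [w [abw sw sub1 sub2]] := itv_partition_common ab abs abt szn.
exists w; split=> // j jp /=.
pose Q f u v := exists g : R -> R, solves_on D `[u, v]%classic g /\
  forall x, x \in `]u, v[ -> f x = g x.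
have Qmono f0 u u' v' v : u <= u' -> v' <= v -> Q f0 u v -> Q f0 u' v'.
  move=> uu' vv' [g0 [gs fg]]; exists g0; split=> [|x xuv].
    by apply: solves_on_subset gs; apply: subset_itv; rewrite bnd_simp.
  apply: fg; move: xuv; rewrite !in_itv/= => /andP[ux xv].
  by rewrite (le_lt_trans uu')//= (lt_le_trans xv).
have jw : (j < size w)%N by rewrite sw ltnS.
have [|g1 [g1s fg1]] := itv_partition_refine (Qmono f) abs abw sub1 _ jw.
  by move=> i; rewrite ss ltnS; exact: fs.
have [|g2 [g2s fg2]] := itv_partition_refine (Qmono g) abt abw sub2 _ jw.
  by move=> i; rewrite st ltnS; exact: gt.
exists (g1 \- g2); split; first exact: solves_onB.
by move=> x xuv /=; rewrite fg1// fg2.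
Qed.

(** * Integrability and linearity of moments *)

Lemma measurable_fun_itv_partition (R : realType) (a b : R) (s : seq R)
    (f : R -> R) :
    itv_partition a b s ->
    (forall j, (j < size s)%N ->
      measurable_fun `[nth b (a :: s) j, nth b (a :: s) j.+1]%classic f) ->
  measurable_fun `[a, b]%classic f.
Proof.
elim: s a => [|c s IH] a abs mf.
  rewrite (itv_partition_nil abs) set_itv1; exact: measurable_fun_set1.
have /= [ac cb] : a <= c /\ c <= b.
  split; last exact: itv_partition_le (itv_partition_cons abs).
  by case: abs => /= /andP[/ltW].
rewrite (@itv_bndbnd_setU _ _ (BLeft a) (BRight c) (BRight b)) ?bnd_simp//.
apply/measurable_funU => //; split; first exact: (mf 0%N).
apply/measurable_fun_itv_obnd_cbndP; apply: IH => [|j js].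
  exact: itv_partition_cons abs.
exact: (mf j.+1).
Qed.

Lemma PD_measurable (R : realType) (a b : R) (D : diff_op R) (p : nat)
    (f : R -> R) :
  PD a b D p f -> measurable_fun `[a, b]%classic f.
Proof.
move=> [_ [s [abs ss fs]]]; apply: measurable_fun_itv_partition abs _ => j.
rewrite ss ltnS => /fs /= [g [[cg _] fg]].
(* The arbitrary values of [f] at the two endpoints do not affect measurability, so the open piece
   suffices. *)
apply: (@measurable_fun_itv_cc _ _ _ false true).
apply: (@eq_measurable_fun _ _ _ _ _ g) => [x|].
  by rewrite inE/= => /fg.
apply: subspace_continuous_measurable_fun => //.
by apply: continuous_subspaceW cg; exact: subset_itv_oo_cc.
Qed.

(** The power is continuous, hence integrable, on a compact interval, and [f] is a bounded
    measurable factor. This is what makes the integral additive in [momentB]. *)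
Lemma PD_integrable (R : realType) (a b : R) (D : diff_op R) (p k : nat)
    (f : R -> R) :
  PD a b D p f ->
  (@lebesgue_measure R).-integrable `[a, b]%classic
    (EFin \o (fun x => x ^+ k * f x)).
Proof.
move=> fPD; have [bf _] := fPD.
have := @integrableMl _ _ R lebesgue_measure `[a, b]%classic _
  (EFin \o (fun x => x ^+ k)) f.
apply=> //.
- apply: continuous_compact_integrable; first exact: segment_compact.
  by apply: continuous_subspaceT => x; exact: exprn_continuous.
- exact: PD_measurable fPD.
Qed.

Lemma momentB (R : realType) (a b : R) (D : diff_op R) (p q k : nat)
    (f g : R -> R) :
  PD a b D p f -> PD a b D q g ->
  moment a b k (f \- g) = moment a b k f - moment a b k g.
Proof.
move=> fPD gPD; rewrite /moment -RintegralB//; first last.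
- exact: PD_integrable gPD.
- exact: PD_integrable fPD.
by apply: eq_Rintegral => x _; rewrite mulrBr.
Qed.

Theorem lemma1 (R : realType) (a b : R) (hab : (a < b)%R) (D : diff_op R)
    (p : nat) :
  (moment_uniqueness_index a b D p <= moment_vanishing_index a b D (2 * p))%E.
Proof.
(* Adding 1 is monotone, so it suffices to include one set of [k] in the other; this also covers
   empty and unbounded sets. *)
apply: leeD2r; apply: ereal_sup_le => _ [k [f [g [fPD gPD fg mfg]]] <-].
exists k => //; exists (f \- g); split; first exact: PDB.
- apply: contra_not fg.
  apply: filterS; first exact: (ae_filter_ringOfSetsType lebesgue_measure).
  move=> x fg0 Dx.
  by apply/eqP; rewrite -subr_eq0; apply/eqP; exact: fg0.
- by move=> j jk; rewrite (momentB j fPD gPD) mfg// subrr.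
Qed.
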